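(* Let $\{e_j\}_{j\in\mathbb{N}_0}$ be unit vectors in a Hilbert space $\mathscr{H}$, let $P_j=|e_j\rangle\langle e_j|$, set $Q_0=P_0$, $Q_n=P_n(1-P_{n-1})\cdots(1-P_0)$ for $n\ge1$, and let $g_j\in\mathscr{H}$ be the unique vector with $Q_j=|e_j\rangle\langle g_j|$. Then the system $\{|e_j\rangle\langle e_j|\}_{j\in\mathbb{N}_0}$ is effective if and only if $\{g_j\}_{j\in\mathbb{N}_0}$ is a Parseval frame in $\mathscr{H}$.
   Context: $\mathbb{N}_0=\{0,1,2,\dots\}$. The inner product is linear in the second variable. For $u,v\in\mathscr{H}$, $|u\rangle\langle v|$ is the operator $x\mapsto\langle v,x\rangle u$; $1$ denotes the identity operator. A system $\{P_j\}_{j\in\mathbb{N}_0}$ of selfadjoint projections is called effective if $T_n:=(1-P_n)(1-P_{n-1})\cdots(1-P_0)\to0$ in the strong operator topology, i.e. $\lim_n\|T_nx\|=0$ for every $x\in\mathscr{H}$. Each $Q_j$ has range in the span of $e_j$, so $g_j$ exists and is unique. A family $\{g_j\}$ is a Parseval frame in $\mathscr{H}$ if $\sum_j|\langle g_j,x\rangle|^2=\|x\|^2$ for all $x\in\mathscr{H}$. *)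

(* Defs.v *)
From HB Require Import structures.
From mathcomp Require Import all_boot all_order all_algebra.
From mathcomp Require Import complex.
From mathcomp Require Import all_classical all_reals all_analysis.

Set Implicit Arguments.
Unset Strict Implicit.
Unset Printing Implicit Defensive.

Import Order.TTheory GRing.Theory Num.Theory.
Import numFieldNormedType.Exports.

Local Open Scope classical_set_scope.
Local Open Scope ring_scope.

(* A complex Hilbert space is a complete normed module over R[i] together with
   a positive definite hermitian form inducing its norm. *)
Definition induces_norm (R : realType) (H : completeNormedModType R[i])
    (form : {dot H for Num.conj}) : Prop :=
  forall x : H, form x x = `|x| ^+ 2.

Section Operators.
Variables (R : realType) (H : completeNormedModType R[i]).
Variable form : {dot H for Num.conj}.

(* The library's forms are linear in the first argument; the inner product
   <u, v> used here is linear in the second one. *)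
Definition inner (u v : H) : R[i] := form v u.

Definition ketbra (u v : H) : H -> H := fun x => inner v x *: u.

Definition selfadjoint_projection (P : H -> H) : Prop :=
  [/\ linear P,
      forall x, P (P x) = P x &
      forall x y, inner (P x) y = inner x (P y)].

(* (1 - P_n) (1 - P_{n-1}) ... (1 - P_0) *)
Fixpoint kaczmarz_prod (P : nat -> H -> H) (n : nat) : H -> H :=
  if n is m.+1 then (idfun \- P m.+1) \o kaczmarz_prod P m
  else idfun \- P 0%N.

(* Norms on H take their values in R[i], whose topology lives on R[i]^o. *)
Definition effective (P : nat -> H -> H) : Prop :=
  (forall j, selfadjoint_projection (P j)) /\
  (forall x : H,
     (fun n => `|kaczmarz_prod P n x| : R[i]^o) @ \oo --> (0 : R[i]^o)).

(* P_n (1 - P_{n-1}) ... (1 - P_0) *)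
Definition kaczmarz_op (P : nat -> H -> H) (n : nat) : H -> H :=
  if n is m.+1 then P m.+1 \o kaczmarz_prod P m else P 0%N.

Definition parseval_frame (g : nat -> H) : Prop :=
  forall x : H,
    series (fun j => `|inner (g j) x| ^+ 2 : R[i]^o) @ \oo
      --> (`|x| ^+ 2 : R[i]^o).

End Operators.

(* Main.v *)
Require Import Defs.
From HB Require Import structures.
From mathcomp Require Import all_boot all_order all_algebra.
From mathcomp Require Import complex.
From mathcomp Require Import all_classical all_reals all_analysis.
Import Order.TTheory GRing.Theory Num.Theory.
Import numFieldNormedType.Exports.
Local Open Scope ring_scope.

(** Each factor [1 - P_n] of the product [T_n = (1 - P_n) ... (1 - P_0)] splits
    a vector orthogonally: applied to [T_(n-1) x], it keeps [T_n x] and discards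
    [P_n T_(n-1) x = Q_n x].  Pythagoras at each step telescopes
    ([sum_sqr_kaczmarz_op]) to
      [|Q_0 x|^2 + ... + |Q_n x|^2 = |x|^2 - |T_n x|^2].
    For [P_j = |e_j><e_j|] with [e_j] a unit vector, [Q_j x] is the multiple
    [<g_j, x> e_j], so the left-hand side is a partial sum of the series of the
    [|<g_j, x>|^2].  This series therefore sums to [|x|^2] exactly when
    [|T_n x|^2], equivalently [|T_n x|], tends to [0]. *)

Lemma cvgr0_sqr (K : numFieldType) (T : Type) (F : set_system T) (FF : Filter F)
    (f : T -> K^o) :
  (f @ F --> (0 : K^o))%classic <->
  ((fun x => f x ^+ 2 : K^o) @ F --> (0 : K^o))%classic.
Proof.
split=> [f0|/cvgr0Pnorm_lt f20].
  by rewrite -[0](mulr0 (0 : K)); under eq_fun do rewrite expr2; exact: cvgM.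
apply/cvgr0Pnorm_lt => eps eps0.
near=> x.
rewrite -(ltr_pXn2r (n := 2)) ?nnegrE ?normr_ge0 ?(ltW eps0)// -normrX.
near: x; apply: f20; exact: exprn_gt0.
Unshelve. all: by end_near. Qed.

Section Kaczmarz.
Context (R : realType) (H : completeNormedModType R[i]).
Context (form : {dot H for Num.conj}) (form_norm : induces_norm form).

Lemma norm_ketbra (u v x : H) :
  `|u| = 1 -> `|ketbra form u v x| = `|inner form v x|.
Proof. by move=> u1; rewrite /ketbra normrZ u1 mulr1. Qed.

Lemma ketbra_selfadjoint_projection (u : H) :
  `|u| = 1 -> selfadjoint_projection form (ketbra form u u).
Proof.
move=> u1; have uu : form u u = 1 by rewrite form_norm u1 expr1n.
split=> [a x y|x|x y]; rewrite /ketbra.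
- by rewrite /inner linearPl scalerDl scalerA.
- by rewrite /inner linearZl_LR /= uu mulr1.
- rewrite /inner linearZl_LR linearZr_LR /=.
  by rewrite (hermC form u x) expr0 mul1r mulrC.
Qed.

(** Selfadjointness and idempotence make the cross term [<y, P y>] equal to
    [|P y|^2]. *)
Lemma selfadjoint_projection_pythagoras (P : H -> H) (y : H) :
  selfadjoint_projection form P -> `|y| ^+ 2 = `|y - P y| ^+ 2 + `|P y| ^+ 2.
Proof.
move=> [_ PP Psa].
have cross : form y (P y) = `|P y| ^+ 2.
  by have := Psa y (P y); rewrite PP -form_norm /inner => ->; exact: (Psa y y).
rewrite -!form_norm dnormB cross !form_norm conj_Creal ?rpredX ?normr_real//.
by rewrite opprD addrA addrK subrK.
Qed.

Lemma sum_sqr_kaczmarz_op (P : nat -> H -> H) (n : nat) (x : H) :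
  (forall j, selfadjoint_projection form (P j)) ->
  \sum_(0 <= j < n.+1) `|kaczmarz_op P j x| ^+ 2
    = `|x| ^+ 2 - `|kaczmarz_prod P n x| ^+ 2.
Proof.
move=> Pproj; elim: n => [|n IHn].
  rewrite big_nat1 /= (selfadjoint_projection_pythagoras (P 0) x (Pproj 0)).
  by rewrite addrAC subrr add0r.
rewrite big_nat_recr //= IHn.
rewrite (selfadjoint_projection_pythagoras (P n.+1)
  (kaczmarz_prod P n x) (Pproj n.+1)).
by rewrite opprD addrA subrK.
Qed.

End Kaczmarz.

Theorem corollary3p17 (R : realType) (H : completeNormedModType R[i])
    (form : {dot H for Num.conj}) (form_norm : induces_norm form)
    (e : nat -> H) (e_unit : forall j, `|e j| = 1)
    (g : nat -> H)
    (gP : forall j, kaczmarz_op (fun k => ketbra form (e k) (e k)) j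
                    = ketbra form (e j) (g j)) :
  effective form (fun j => ketbra form (e j) (e j)) <-> parseval_frame form g.
Proof.
set P := fun j => ketbra form (e j) (e j).
have Pproj j : selfadjoint_projection form (P j).
  exact: ketbra_selfadjoint_projection.
have partial_sum x n : series (fun j => `|inner form (g j) x| ^+ 2 : R[i]^o) n.+1
    = `|x| ^+ 2 - `|kaczmarz_prod P n x| ^+ 2.
  rewrite -(sum_sqr_kaczmarz_op _ _ _ form_norm)//.
  apply: eq_bigr => j _.
  by rewrite gP norm_ketbra.
have pointwise x : ((fun n => `|kaczmarz_prod P n x| : R[i]^o) @ \oo -->
      (0 : R[i]^o))%classic <->
    (series (fun j => `|inner form (g j) x| ^+ 2 : R[i]^o) @ \oo -->
      (`|x| ^+ 2 : R[i]^o))%classic.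
  (* The shift matches the n+1 terms |Q_0 x|^2, ..., |Q_n x|^2 with the n+1
     factors of T_n. *)
  rewrite cvgr0_sqr -[X in _ <-> X]cvg_shiftS -[X in _ <-> X]subr_cvg0.
  rewrite [X in _ <-> (X @ _ --> _)%classic](_ : _ =
    (fun n => - (`|kaczmarz_prod P n x| ^+ 2) : R[i]^o)); last first.
    by apply/funext => n; rewrite /= partial_sum addrAC subrr sub0r.
  have := cvgNP (F := \oo%classic)
    (fun n => `|kaczmarz_prod P n x| ^+ 2 : R[i]^o) 0.
  by rewrite oppr0 => signP; exact: (iff_sym (signP _)).
split=> [[_ eff] x|pars]; first exact/pointwise.
by split=> // x; exact/pointwise.
Qed.
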